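(* Let $(\bar p,\bar x)\in\mathbb{P}\times\mathbb{X}$. Suppose that: (i) $\bar x\in\mathcal{S}(\bar p)$; (ii) the set-valued mapping $p\mapsto F(p,\bar x)$ is Hausdorff $C$-u.s.c. at $\bar p$; (iii) there exists $\delta_1>0$ such that for every $p\in \mathrm{B}(\bar p,\delta_1)$ the set-valued mapping $x\mapsto F(p,x)$ is l.s.c. on $\mathbb{X}$; (iv) there exists $\delta_2>0$ such that, for every $p\in \mathrm{B}(\bar p,\delta_2)$, the set-valued mapping $x\mapsto F(p,x)$ admits an outer prederivative $H_{F(p,\cdot)}(x;\cdot):\mathbb{X}\rightrightarrows\mathbb{Y}$ at each point $x\in \mathrm{B}(\bar x,\delta_2)$; (v) it holds $$\sigma_H(\bar p,\bar x)=\inf\{\sigma_{H_{F(p,\cdot)}}(x)\ |\ (p,x)\in [\mathrm{B}(\bar p,\delta_2)\times \mathrm{B}(\bar x,\delta_2)]\setminus\mathrm{graph}\,\mathcal{S}\}>0.$$ Then there exist positive $\eta$ and $\zeta$ such that $$\mathrm{dist}(x,\mathcal{S}(p))\le\frac{\nu_{F,C}(p,x)}{\sigma_H(\bar p,\bar x)},\qquad\forall (p,x)\in \mathrm{B}(\bar p,\zeta)\times \mathrm{B}(\bar x,\eta).$$ If, in addition, (vi) there exist positive $\tau$ and $s$ such that for every $x\in \mathrm{B}(\bar x,s)$ the set-valued mapping $p\mapsto F(p,x)$ is Lipschitz with rate $\ell$ in $\mathrm{B}(\bar p,\tau)$, then $\mathcal{S}$ is Aubin continuous at $(\bar p,\bar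 x)$ and $$\mathrm{lip}\,\mathcal{S}(\bar p,\bar x)\le \frac{\ell}{\sigma_H(\bar p,\bar x)}.$$
   Context: Standing assumptions: $(\mathbb{P},\|\cdot\|)$ and $(\mathbb{Y},\|\cdot\|)$ are normed vector spaces, $(\mathbb{X},\|\cdot\|)$ is a Banach space, $\mathbb{P}\times\mathbb{X}$ carries the max-norm, $C\subset\mathbb{Y}$ is a closed convex cone with $\mathrm{int}\,C\ne\varnothing$, and $F:\mathbb{P}\times\mathbb{X}\rightrightarrows\mathbb{Y}$ is a set-valued mapping with nonempty values everywhere. The solution mapping $\mathcal{S}:\mathbb{P}\rightrightarrows\mathbb{X}$ of the parameterized set-valued inclusion $F(p,x)\subseteq C$ is $\mathcal{S}(p)=\{x\in\mathbb{X}\ |\ F(p,x)\subseteq C\}$; $\mathrm{graph}\,\mathcal{S}=\{(p,x)\ |\ x\in\mathcal{S}(p)\}$. Notation: $\mathrm{B}(x,r)$ is the closed ball with center $x$ and radius $r$; $\mathbb{B}$ is the closed unit ball and $\mathbb{S}$ the unit sphere of the relevant space; $\mathrm{dist}(x,S)=\inf_{z\in S}\|x-z\|$ (with $\inf\varnothing=+\infty$), $\mathrm{B}(S,r)=\{x\ |\ \mathrm{dist}(x,S)\le r\}$; $\mathrm{exc}(A,B)=\sup_{a\in A}\mathrm{dist}(a,B)$; $\mathrm{haus}(A,B)=\max\{\mathrm{exc}(A,B),\mathrm{exc}(B,A)\}$; $\sup\varnothing=-\infty$. The merit function is $\nu_{F,C}(p,x)=\mathrm{exc}(F(p,x),C)=\sup_{y\in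 F(p,x)}\mathrm{dist}(y,C)\in[0,+\infty]$. Quotients: $(+\infty)/\sigma=+\infty$ for every $\sigma\in(0,+\infty]$, and $a/(+\infty)=0$ for finite $a\ge 0$. A set-valued mapping $\Phi$ is l.s.c. at $x_0$ if for every open $V$ with $\Phi(x_0)\cap V\ne\varnothing$ there is a neighbourhood $U$ of $x_0$ with $\Phi(x)\cap V\neq\varnothing$ for all $x\in U$. $\Phi$ is Hausdorff $C$-u.s.c. at $x_0$ if for every $\epsilon>0$ there is $\delta>0$ such that $\Phi(x)\subseteq \mathrm{B}(\Phi(x_0)+C,\epsilon)$ for all $x\in \mathrm{B}(x_0,\delta)$. $\Phi$ is Lipschitz with rate $\ell>0$ in $S$ if $\mathrm{haus}(\Phi(p_1),\Phi(p_2))\le\ell\, d(p_1,p_2)$ for all $p_1,p_2\in S$. A set-valued mapping $H$ is positively homogeneous if $H(tx)=tH(x)$ for all $t>0$. A positively homogeneous mapping $H_\Phi(x_0;\cdot):\mathbb{X}\rightrightarrows\mathbb{Y}$ is an outer prederivative of $\Phi:\mathbb{X}\rightrightarrows\mathbb{Y}$ at $x_0$ if for every $\epsilon>0$ there is $\delta>0$ such that $\Phi(x)\subseteq \Phi(x_0)+H_\Phi(x_0;x-x_0)+\epsilon\|x-x_0\|\mathbb{B}$ for all $x\in \mathrm{B}(x_0,\delta)$. For $K,S\subseteq\mathbb{Y}$, $K{*\over{}}S=\{y\in\mathbb{Y}\ |\ y+S\subseteq K\}$ is the $\ast$-difference and $|K{*\over{}}S|=\sup\{r>0\ |\ r\mathbb{B}\subseteq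 K{*\over{}}S\}$. Then $\sigma_{H_{F(p,\cdot)}}(x)=\sup_{u\in\mathbb{S}}\,|C{*\over{}}H_{F(p,\cdot)}(x;u)|$, where $u$ ranges over the unit sphere of $\mathbb{X}$. A set-valued mapping $\Phi$ between metric spaces $P$ and $X$ is Aubin continuous at $(\bar p,\bar x)\in\mathrm{graph}\,\Phi$ with rate $\kappa>0$ if there exist $\delta,r>0$ such that $\mathrm{dist}(x,\Phi(p_1))\le\kappa d(p_1,p_2)$ for all $p_1,p_2\in \mathrm{B}(\bar p,\delta)$ and all $x\in\Phi(p_2)\cap \mathrm{B}(\bar x,r)$; $\mathrm{lip}\,\Phi(\bar p,\bar x)$ is the infimum of all such rates $\kappa$. *)

(* Defs.v *)
From HB Require Import structures.
From mathcomp Require Import all_boot all_order all_algebra.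
From mathcomp Require Import all_classical all_reals all_analysis.

Set Implicit Arguments.
Unset Strict Implicit.
Unset Printing Implicit Defensive.

Import Order.TTheory GRing.Theory Num.Theory.
Import numFieldNormedType.Exports.

Local Open Scope classical_set_scope.
Local Open Scope ring_scope.

(* The library's [closed_ball] is the closure of an open ball, hence empty for
   radius 0; this one is the closed ball for every radius. *)
Definition cball (R : realType) (V : normedModType R) (x : V) (r : R) : set V :=
  closed_ball_ Num.norm x r.

Definition usphere (R : realType) (V : normedModType R) : set V :=
  [set u | `|u| = 1].

Definition set_add (R : realType) (V : normedModType R) (A B : set V) : set V :=
  [set a + b | a in A & b in B].

Definition set_scale (R : realType) (V : normedModType R) (t : R) (A : set V) :
  set V := [set t *: a | a in A].

(* [ereal_inf set0 = +oo] and [ereal_sup set0 = -oo]. *)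
Definition dist (R : realType) (V : normedModType R) (x : V) (S : set V) :
  \bar R := ereal_inf [set `|x - z|%:E | z in S].

Definition enlargement (R : realType) (V : normedModType R) (S : set V)
  (r : R) : set V := [set x | (dist x S <= r%:E)%E].

Definition exc (R : realType) (V : normedModType R) (A B : set V) : \bar R :=
  ereal_sup [set dist a B | a in A].

Definition haus (R : realType) (V : normedModType R) (A B : set V) : \bar R :=
  Order.max (exc A B) (exc B A).

(* In the library [+oo / +oo = +oo * 0 = 0]; here [+oo / s = +oo] for every
   [0 < s <= +oo]. *)
Definition equot (R : realType) (a s : \bar R) : \bar R :=
  (if a == +oo then +oo else a / s)%E.

Definition cone (R : realType) (V : normedModType R) (C : set V) : Prop :=
  forall (t : R) (y : V), 0 < t -> C y -> C (t *: y).

(* Set-valued mappings from U to V are functions [U -> set V]. *)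

Definition lsc_at (R : realType) (U V : normedModType R) (Phi : U -> set V)
  (x0 : U) : Prop :=
  forall W : set V, open W -> Phi x0 `&` W !=set0 ->
    \forall x \near x0, Phi x `&` W !=set0.

Definition hausdorff_usc_at (R : realType) (U V : normedModType R) (C : set V)
  (Phi : U -> set V) (x0 : U) : Prop :=
  forall e : R, 0 < e -> exists2 d : R, 0 < d &
    forall x, cball x0 d x -> Phi x `<=` enlargement (set_add (Phi x0) C) e.

Definition lipschitz_rate_in (R : realType) (U V : normedModType R)
  (Phi : U -> set V) (l : R) (S : set U) : Prop :=
  forall p1 p2, S p1 -> S p2 ->
    (haus (Phi p1) (Phi p2) <= (l * `|p1 - p2|)%:E)%E.

Definition pos_homogeneous (R : realType) (U V : normedModType R)
  (H : U -> set V) : Prop :=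
  forall (t : R) (x : U), 0 < t -> H (t *: x) = set_scale t (H x).

Definition outer_prederivative (R : realType) (U V : normedModType R)
  (Phi : U -> set V) (x0 : U) (H : U -> set V) : Prop :=
  pos_homogeneous H /\
  forall e : R, 0 < e -> exists2 d : R, 0 < d &
    forall x, cball x0 d x ->
      Phi x `<=` set_add (set_add (Phi x0) (H (x - x0)))
                         (set_scale (e * `|x - x0|) (cball 0 1)).

Definition star_diff (R : realType) (V : normedModType R) (K S : set V) :
  set V := [set y | [set y + s | s in S] `<=` K].

Definition inner_radius (R : realType) (V : normedModType R) (A : set V) :
  \bar R := ereal_sup [set r%:E | r in [set r : R | 0 < r /\
                                          set_scale r (cball 0 1) `<=` A]].

(* [H] is the outer prederivative at one fixed point. *)
Definition sigma_prederiv (R : realType) (U V : normedModType R) (C : set V)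
  (H : U -> set V) : \bar R :=
  ereal_sup [set inner_radius (star_diff C (H u)) | u in @usphere R U].

Definition sol (R : realType) (P X Y : normedModType R)
  (F : P * X -> set Y) (C : set Y) (p : P) : set X :=
  [set x | F (p, x) `<=` C].

Definition sv_graph (R : realType) (U V : normedModType R)
  (Phi : U -> set V) : set (U * V) := [set z | Phi z.1 z.2].

Definition merit (R : realType) (P X Y : normedModType R)
  (F : P * X -> set Y) (C : set Y) (p : P) (x : X) : \bar R :=
  exc (F (p, x)) C.

(* [H p x] stands for the prederivative of [F(p, .)] at [x]. *)
Definition sigma_inf (R : realType) (P X Y : normedModType R)
  (F : P * X -> set Y) (C : set Y) (H : P -> X -> X -> set Y)
  (pbar : P) (xbar : X) (d : R) : \bar R :=
  ereal_inf [set sigma_prederiv C (H z.1 z.2) |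
             z in (cball pbar d `*` cball xbar d) `\` sv_graph (sol F C)].

Definition aubin_rate (R : realType) (U V : normedModType R)
  (Phi : U -> set V) (pbar : U) (xbar : V) (k : R) : Prop :=
  [/\ sv_graph Phi (pbar, xbar), 0 < k &
    exists d r : R, [/\ 0 < d, 0 < r &
      forall p1 p2 x, cball pbar d p1 -> cball pbar d p2 ->
        Phi p2 x -> cball xbar r x ->
        (dist x (Phi p1) <= (k * `|p1 - p2|)%:E)%E]].

Definition aubin_continuous (R : realType) (U V : normedModType R)
  (Phi : U -> set V) (pbar : U) (xbar : V) : Prop :=
  exists k : R, aubin_rate Phi pbar xbar k.

Definition lip (R : realType) (U V : normedModType R)
  (Phi : U -> set V) (pbar : U) (xbar : V) : \bar R :=
  ereal_inf [set k%:E | k in [set k : R | aubin_rate Phi pbar xbar k]].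

(* Main.v *)
Require Import Defs.
From HB Require Import structures.
From mathcomp Require Import all_boot all_order all_algebra.
From mathcomp Require Import all_classical all_reals all_analysis.
From mathcomp Require Import ring lra.

Set Implicit Arguments.
Unset Strict Implicit.
Unset Printing Implicit Defensive.

Import Order.TTheory GRing.Theory Num.Theory.
Import numFieldNormedType.Exports.

Local Open Scope classical_set_scope.
Local Open Scope ring_scope.

(** The merit function x |-> exc (F (p, x)) C vanishes exactly on the solution
    set of the parameter p, and it decreases along suitable rays with any slope
    below sigma. Indeed, at a point x that is not a solution some unit direction
    u is such that C contains h + r b for every h in H(p, x; u) and every b in
    the unit ball, with r > a, for any given a < sigma. To first order,
    F (p, x + t u) lies in F (p, x) + t H(p, x; u); moving from y0 in F (p, x)
    to y0 + t h moves closer to C by r t, because the ball of radius r t around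
    t h is added to a convex cone ([cone_dist_shift]). The first-order error
    costs at most (r - a) t, so the merit drops by a t ([exc_descent]).

    A nonnegative lower semicontinuous function on a Banach space that has such
    a descent at every nonzero point must vanish at distance at most
    (initial value) / a: Ekeland's variational principle ([ekeland]) produces a
    point with no descent, which is therefore a solution
    ([local_error_bound]). The argument is local: the point found by Ekeland's
    principle has to stay where the prederivatives are controlled, which
    forces the initial merit to be small. That fails for general (p, x) near
    (pbar, xbar), since the merit is not assumed upper semicontinuous in x.
    But Hausdorff C-upper semicontinuity makes the merit small at (p, xbar),
    so that a solution exists near xbar, and this solution is close enough to x
    whenever the merit at (p, x) is not small ([uniform_error_bound]).

    All this is done for real slopes a < sigma, on a neighbourhood that does not
    depend on a; [le_equot] lets a tend to sigma, whether sigma is finite or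
    not. Finally, a solution for p2 has merit at most l |p1 - p2| for p1 by the
    Lipschitz property, so the error bound yields the Aubin rates l / a. *)

(** * Ekeland's variational principle *)

(** Ekeland's preorder, read as: z improves on x for f at rate at least a. *)
Definition ekeland_le (R : realType) (X : normedModType R) (f : X -> \bar R)
    (a : R) (x z : X) : Prop :=
  (f z + (a * `|z - x|)%:E <= f x)%E.

Lemma ekeland_le_refl (R : realType) (X : normedModType R) (f : X -> \bar R)
  (a : R) (x : X) : ekeland_le f a x x.
Proof. by rewrite /ekeland_le subrr normr0 mulr0 adde0. Qed.

Lemma ekeland_le_trans (R : realType) (X : normedModType R) (f : X -> \bar R)
  (a : R) (x y z : X) : 0 <= a ->
  ekeland_le f a x y -> ekeland_le f a y z -> ekeland_le f a x z.
Proof.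
move=> a0 xy yz; rewrite /ekeland_le; apply: le_trans xy.
apply: le_trans (leeD2r _ yz); rewrite -addeA leeD2l// lee_fin -mulrDr.
rewrite ler_wpM2l// (le_trans _ (ler_normD _ _))//.
by rewrite addrA subrK.
Qed.

Lemma ekeland_le_fin (R : realType) (X : normedModType R) (f : X -> \bar R)
  (a : R) (x z : X) : (forall x, 0 <= f x)%E -> (f x < +oo)%E -> 0 <= a ->
  ekeland_le f a x z ->
  (f z < +oo)%E /\ fine (f z) + a * `|z - x| <= fine (f x).
Proof.
rewrite /ekeland_le => f0 fx a0.
move: (f0 x) (f0 z) fx; case: (f x) => [r| |]//; case: (f z) => [s| |]//= _ _ _.
by rewrite -EFinD lee_fin ltry.
Qed.

(** One step of the iteration: choose z in the section of x with value below
    the midpoint of f x and the infimum m of f on that section. Every w beyond z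
    then has f z - f w <= f z - m <= f x - f z, so the drop already achieved
    bounds all the drops to come, and with them the size of the section of z. *)
Lemma ekeland_step (R : realType) (X : normedModType R) (f : X -> \bar R)
  (a : R) (x : X) : 0 <= a -> (forall x, 0 <= f x)%E -> (f x < +oo)%E ->
  exists2 z, ekeland_le f a x z & forall w, ekeland_le f a z w ->
    a * `|w - z| <= fine (f x) - fine (f z).
Proof.
move=> a0 f0 fx.
set m := ereal_inf (f @` ekeland_le f a x).
have m_le w : ekeland_le f a x w -> (m <= f w)%E.
  by move=> xw; apply: ereal_inf_lbound; exists w.
have m0 : (0 <= m)%E by apply: le_ereal_inf_tmp => _ [w _ <-].
have mx : (m <= f x)%E by apply/m_le/ekeland_le_refl.
have mE : m = (fine m)%:E by rewrite fineK// ge0_fin_numE// (le_lt_trans mx).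
have fxE : f x = (fine (f x))%:E by rewrite fineK// ge0_fin_numE.
(* When x already minimizes f on its section, the midpoint is not strictly
   above the infimum, but z = x works. *)
have [mltx|xlem] := ltP m (f x); last first.
  exists x => [|w xw]; first exact: ekeland_le_refl.
  have [fw le] := ekeland_le_fin f0 fx a0 xw.
  have fwE : f w = (fine (f w))%:E by rewrite fineK// ge0_fin_numE.
  have := le_trans xlem (m_le _ xw); rewrite fxE fwE lee_fin; lra.
have : (m < ((fine m + fine (f x)) / 2)%:E)%E.
  rewrite mE lte_fin; move: mltx; rewrite mE fxE lte_fin /=; lra.
move=> /ereal_inf_lt[_ [z xz <-] fz]; exists z => // w zw.
have [fzy _] := ekeland_le_fin f0 fx a0 xz.
have [fwy le] := ekeland_le_fin f0 fzy a0 zw.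
have := m_le _ (ekeland_le_trans a0 xz zw).
have fzE : f z = (fine (f z))%:E by rewrite fineK// ge0_fin_numE.
have fwE : f w = (fine (f w))%:E by rewrite fineK// ge0_fin_numE.
move: fz; rewrite {1}fzE mE fwE lte_fin lee_fin; lra.
Qed.

(** Sections of the preorder are closed, by lower semicontinuity. *)
Lemma ekeland_le_cvg (R : realType) (X : normedModType R) (f : X -> \bar R)
  (a : R) (x z : X) (u : nat -> X) : 0 < a -> lower_semicontinuous f ->
  (forall x, 0 <= f x)%E -> (f x < +oo)%E ->
  (\forall n \near \oo, ekeland_le f a x (u n)) ->
  u @ \oo --> z -> ekeland_le f a x z.
Proof.
move=> a0 flsc f0 fx xu uz.
have fxE : f x = (fine (f x))%:E by rewrite fineK// ge0_fin_numE.
rewrite /ekeland_le leNgt; apply/negP => lt.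
have {}lt : ((fine (f x) - a * `|z - x|)%:E < f z)%E.
  by rewrite EFinB -fxE lteBlDr.
have [e e0 lte] : exists2 e, 0 < e &
    ((fine (f x) - a * `|z - x| + e)%:E < f z)%E.
  apply: contrapT => nex; move: lt; rewrite ltNge => /negP; apply.
  apply/lee_addgt0Pr => e e0; rewrite -EFinD leNgt; apply/negP => he.
  by apply: nex; exists e.
have [W zW Wf] := flsc z _ lte.
have near_u : \forall n \near \oo, `|z - u n| < e / a.
  by move/cvgrPdist_lt: uz; apply; rewrite divr_gt0.
have [n [[/ekeland_le_fin le zun] /Wf fun_]] :=
  filter_ex (filterI (filterI xu near_u) (uz _ zW)).
have {le}[fuy le] := le f0 fx (ltW a0).
have funE : f (u n) = (fine (f (u n)))%:E by rewrite fineK// ge0_fin_numE.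
move: zun fun_; rewrite /= funE lte_fin ltr_pdivlMr// => zun fun_.
have : `|z - x| <= `|z - u n| + `|u n - x|.
  by rewrite (le_trans _ (ler_normD _ _))// addrA subrK.
by move=> /(ler_wpM2l (ltW a0)); rewrite mulrDr; lra.
Qed.

(** The iterates of [ekeland_step] have nested closed sections whose diameters
    are controlled by the drops of a decreasing sequence bounded below, hence
    tend to 0. Completeness gives a common point, whose own section, contained
    in all of these, is a singleton. *)
Lemma ekeland (R : realType) (X : completeNormedModType R) (f : X -> \bar R)
  (a : R) (x0 : X) : 0 < a -> lower_semicontinuous f ->
  (forall x, 0 <= f x)%E -> (f x0 < +oo)%E ->
  exists2 z, ekeland_le f a x0 z & forall w, ekeland_le f a z w -> w = z.
Proof.
move=> a0 flsc f0 fx0.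
pose step x z := (f x < +oo)%E -> ekeland_le f a x z /\
  forall w, ekeland_le f a z w -> a * `|w - z| <= fine (f x) - fine (f z).
have [u [u0 uS]] : {u : nat -> X | u 0 = x0 /\ forall n, step (u n) (u n.+1)}.
  apply: dependent_choice => x; apply: cid.
  have [fxy|nfxy] := boolP (f x < +oo)%E; last by exists x; move=> /(negP nfxy).
  by have [z] := ekeland_step (ltW a0) f0 fxy; exists z.
have fu n : (f (u n) < +oo)%E.
  elim: n => [|n IH]; first by rewrite u0.
  by have [/(ekeland_le_fin f0 IH (ltW a0))[]] := uS n IH.
have u_le n m : (n <= m)%N -> ekeland_le f a (u n) (u m).
  elim: m => [|m IH]; first by rewrite leqn0 => /eqP ->; exact: ekeland_le_refl.
  rewrite leq_eqVlt => /predU1P[->|]; first exact: ekeland_le_refl.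
  rewrite ltnS => /IH nm; apply: ekeland_le_trans (ltW a0) nm _.
  by have [] := uS m (fu m).
pose g n := fine (f (u n)).
have g_le n m : (n <= m)%N -> g m <= g n.
  move=> /u_le/(ekeland_le_fin f0 (fu n) (ltW a0))[_]; apply: le_trans.
  by rewrite lerDl mulr_ge0// ltW.
have gcv : cvgn g.
  apply: nonincreasing_is_cvgn => //; exists 0 => _ [n _ <-].
  exact: fine_ge0.
have limg_le n : limn g <= g n.
  by apply: limr_le => //; exists n => // m /= /g_le.
have g_small e : 0 < e -> exists n, g n - limn g < e.
  move=> e0; have /cvgrPdist_lt/(_ _ e0)/filter_ex[n] := gcv; exists n.
  by rewrite (le_lt_trans (ler_norm _))// distrC.
have ucv : cvgn u.
  apply/cauchy_cvgP/cauchy_exP => e e0.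
  have [N gN] := g_small _ (mulr_gt0 e0 a0); exists (u N); exists N => // m /= Nm.
  have [_] := ekeland_le_fin f0 (fu N) (ltW a0) (u_le _ _ Nm).
  rewrite -ball_normE /= distrC -(ltr_pM2r a0) mulrC.
  by have := limg_le m; rewrite -/(g m) -/(g N); lra.
have uz n : ekeland_le f a (u n) (limn u).
  apply: ekeland_le_cvg (fu n) _ ucv => //.
  by exists n => // m /=; exact: u_le.
exists (limn u) => [|w zw]; first by rewrite -u0; exact: uz.
apply/eqP; rewrite -subr_eq0 -normr_le0; apply/ler_addgt0Pr => e e0.
(* Both w and the limit lie in the section of u n.+1, and each is at distance
   at most (g n - g n.+1) / a from u n.+1. *)
have [n gn] := g_small _ (divr_gt0 (mulr_gt0 e0 a0) (ltr0Sn _ 1)).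
have [_ Sn] := uS n (fu n).
have := Sn _ (uz n.+1); have := Sn _ (ekeland_le_trans (ltW a0) (uz n.+1) zw).
have := limg_le n.+1; rewrite -/(g n) -/(g n.+1) add0r -[`|w - _| <= e](ler_pM2r a0).
have : `|w - limn u| <= `|w - u n.+1| + `|limn u - u n.+1|.
  by rewrite -[X in _ <= _ + X]normrN (le_trans _ (ler_normD _ _))// opprB addrA subrK.
by move=> /(ler_wpM2l (ltW a0)); rewrite mulrDr mulrC; lra.
Qed.

(** * Distance and excess *)
Lemma dist_ge0 (R : realType) (V : normedModType R) (x : V) (S : set V) :
  (0 <= dist x S)%E.
Proof. by apply: le_ereal_inf_tmp => _ [z _ <-]; rewrite lee_fin. Qed.

Lemma dist_le (R : realType) (V : normedModType R) (x z : V) (S : set V) :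
  S z -> (dist x S <= `|x - z|%:E)%E.
Proof. by move=> Sz; apply: ereal_inf_lbound; exists z. Qed.

Lemma dist_lt (R : realType) (V : normedModType R) (x : V) (S : set V)
  (r : R) : (dist x S < r%:E)%E -> exists2 z, S z & `|x - z| < r.
Proof. by move=> /ereal_inf_lt[_ [z Sz <-]]; rewrite lte_fin; exists z. Qed.

Lemma dist_triangle (R : realType) (V : normedModType R) (x y : V)
  (S : set V) : (dist x S <= `|x - y|%:E + dist y S)%E.
Proof.
apply/lee_addgt0Pr => e e0.
have [->|dy] := eqVneq (dist y S) +oo%E; first by rewrite /= leey.
have dE : dist y S = (fine (dist y S))%:E.
  by rewrite fineK// ge0_fin_numE ?dist_ge0// ltey.
have [|z Sz yz] := @dist_lt R V y S (fine (dist y S) + e).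
  by rewrite {1}dE lte_fin ltrDl.
apply: le_trans (dist_le _ Sz) _; rewrite dE -!EFinD lee_fin.
have : `|x - z| <= `|x - y| + `|y - z|.
  by rewrite (le_trans _ (ler_normD _ _))// addrA subrK.
lra.
Qed.

Lemma dist_le0 (R : realType) (V : normedModType R) (x : V) (S : set V) :
  closed S -> (dist x S <= 0)%E -> S x.
Proof.
move=> Scl d0; apply: Scl => A /nbhs_ballP[e /= e0 xeA].
have [|z Sz xz] := @dist_lt R V x S e; first by rewrite (le_lt_trans d0)// lte_fin.
by exists z; split => //; apply: xeA; rewrite -ball_normE.
Qed.

Lemma open_dist_gt (R : realType) (V : normedModType R) (S : set V) (r : R) :
  S !=set0 -> open [set y | r%:E < dist y S]%E.
Proof.
move=> [s Ss]; rewrite openE => y /= ry.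
have dE : dist y S = (fine (dist y S))%:E.
  by rewrite fineK// ge0_fin_numE ?dist_ge0// (le_lt_trans (dist_le _ Ss))// ltry.
move: ry; rewrite dE lte_fin => ry.
apply/nbhs_ballP; exists (fine (dist y S) - r); first by rewrite /= subr_gt0.
move=> z; rewrite -ball_normE /= => yz.
have := dist_triangle y z S; rewrite dE leNgt => /negP dyz.
rewrite ltNge; apply/negP => zr; apply: dyz.
apply: le_lt_trans (leeD2l _ zr) _; rewrite -EFinD lte_fin; lra.
Qed.

Lemma exc_leP (R : realType) (V : normedModType R) (A B : set V) (r : \bar R) :
  (exc A B <= r)%E <-> forall a, A a -> (dist a B <= r)%E.
Proof.
split=> [le a Aa|le]; last by apply: ge_ereal_sup => _ [a Aa <-]; exact: le.
by apply: le_trans le; apply: ereal_sup_ubound; exists a.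
Qed.

Lemma dist_le_exc (R : realType) (V : normedModType R) (A B : set V) (a : V) :
  A a -> (dist a B <= exc A B)%E.
Proof. by move=> Aa; apply: ereal_sup_ubound; exists a. Qed.

Lemma exc_ge0 (R : realType) (V : normedModType R) (A B : set V) :
  A !=set0 -> (0 <= exc A B)%E.
Proof. by move=> [a Aa]; apply: le_trans (dist_le_exc _ Aa); exact: dist_ge0. Qed.

Lemma exc_le0 (R : realType) (V : normedModType R) (A B : set V) :
  closed B -> (exc A B <= 0)%E -> A `<=` B.
Proof. by move=> Bcl /exc_leP le a /le; exact: dist_le0. Qed.

Lemma exc_subset_r (R : realType) (V : normedModType R) (A B C : set V) :
  B `<=` C -> (exc A C <= exc A B)%E.
Proof.
move=> BC; apply/exc_leP => a Aa; apply: le_trans (dist_le_exc _ Aa).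
by apply: le_ereal_inf_tmp => _ [z /BC Cz <-]; exact: dist_le.
Qed.

(** If exc (Phi x) C > r, some y in Phi x lies in the open set of the points
    farther than r from C; lower semicontinuity of Phi says that nearby values
    still meet this open set. *)
Lemma exc_lower_semicontinuous (R : realType) (U V : normedModType R)
  (Phi : U -> set V) (C : set V) : C !=set0 ->
  (forall x, lsc_at Phi x) -> lower_semicontinuous (fun x => exc (Phi x) C).
Proof.
move=> C0 lsc x r /ereal_sup_gt[_ [y Py <-] ry].
exists [set x | Phi x `&` [set y | r%:E < dist y C]%E !=set0].
  by apply: lsc; [exact: open_dist_gt|exists y].
by move=> x' /= [y' [Py' ry']]; apply: lt_le_trans ry' (dist_le_exc _ Py').
Qed.

(** * Descent of the excess outside the solution set *)
Lemma convex_cone_add (R : realType) (Y : normedModType R) (C : set Y)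
  (y z : Y) : convex_set C -> cone C -> C y -> C z -> C (y + z).
Proof.
move=> cvx con Cy Cz.
have h0 : (0 : R) <= 2^-1 by lra.
have h1 : (2^-1 : R) <= 1 by lra.
have := cvx y z (Itv01 h0 h1) (mem_set Cy) (mem_set Cz).
move=> /set_mem /(con 2 _ (ltr0Sn _ 1)).
rewrite [X in C X](_ : _ = y + z)//.
rewrite /conv /= scalerDr !scalerA mulfV ?pnatr_eq0// scale1r.
by rewrite (_ : 2 * _ = 1) ?scale1r// /mathcomp.classical.unstable.onem; lra.
Qed.

(** Adding t h to a point leaves room r t for corrections: if w has norm at most
    r t, then c + t h + w is in C as the sum of c and t (h + w / t); otherwise
    truncate w to the norm r t and pay for the remainder. *)
Lemma cone_dist_shift (R : realType) (Y : normedModType R) (C : set Y)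
  (c h w : Y) (r t : R) : convex_set C -> cone C -> C c -> 0 < t -> 0 < r ->
  (forall b, `|b| <= 1 -> C (h + r *: b)) ->
  (dist (c + w + t *: h)%R C <= (Num.max 0 (`|w| - r * t))%:E)%E.
Proof.
move=> cvx con Cc t0 r0 hC.
have trunc b : `|b| <= 1 -> C (c + t *: h + (r * t) *: b).
  move=> b1; rewrite -addrA mulrC -scalerA -scalerDr.
  by apply: convex_cone_add => //; apply: con => //; exact: hC.
have rt0 : 0 < r * t by rewrite mulr_gt0.
have [wrt|rtw] := leP `|w| (r * t).
  apply: le_trans (dist_le _ (trunc ((r * t)^-1 *: w) _)) _.
    rewrite normrZ gtr0_norm ?invr_gt0// mulrC ler_pdivrMr// mul1r //.
  rewrite scalerA divff ?gt_eqF// scale1r (addrAC c w) subrr normr0 lee_fin.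
  by rewrite le_max lexx.
have w0 : 0 < `|w| by apply: lt_trans rtw.
apply: le_trans (dist_le _ (trunc (`|w|^-1 *: w) _)) _.
  by rewrite normrZ normfV normr_id mulVf ?gt_eqF.
rewrite lee_fin le_max; apply/orP; right.
rewrite scalerA (addrAC c w) opprD addrACA subrr add0r.
rewrite -{1}[w]scale1r -scalerBl normrZ ger0_norm.
  by rewrite mulrBl mul1r divfK ?gt_eqF.
by rewrite subr_ge0 ler_pdivrMr// mul1r ltW.
Qed.

(** The slope a is below the inner radius r in some direction u, and the gap
    r - a is spent as the tolerance in the definition of the prederivative. *)
Lemma exc_descent (R : realType) (X Y : normedModType R) (C : set Y)
  (Phi : X -> set Y) (H : X -> set Y) (x : X) (a : R) :
  convex_set C -> cone C -> 0 < a -> (a%:E < sigma_prederiv C H)%E ->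
  outer_prederivative Phi x H ->
  (0 < exc (Phi x) C)%E -> (exc (Phi x) C < +oo)%E ->
  exists2 z, z != x & ekeland_le (fun x => exc (Phi x) C) a x z.
Proof.
move=> cvx con a0 /ereal_sup_gt[_ [u /= u1 <-]].
move=> /ereal_sup_gt[_ [r [r0 rBC] <-]]; rewrite lte_fin => ar [Hhom Hpre].
set m := exc (Phi x) C => m0 moo.
have mE : m = (fine m)%:E by rewrite fineK// ge0_fin_numE// ltW.
have {}m0 : 0 < fine m by rewrite -lte_fin -mE.
have [|d d0 Phi_sub] := Hpre (r - a); first by rewrite subr_gt0.
(* Below d the first-order inclusion holds; below m / a the predicted value
   m - a t is nonnegative, as the distance to C must be. *)
pose t := Num.min d (fine m / a).
have t0 : 0 < t by rewrite lt_min d0 divr_gt0.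
have at_m : a * t <= fine m by rewrite mulrC -ler_pdivlMr// ge_min lexx orbT.
have nzx : `|x + t *: u - x| = t.
  by rewrite addrAC subrr add0r normrZ u1 mulr1 gtr0_norm.
exists (x + t *: u).
  by rewrite -subr_eq0 -normr_eq0 nzx gt_eqF.
rewrite /ekeland_le -/m nzx mE -leeBrDr// -EFinB.
apply/exc_leP => y Py; apply/lee_addgt0Pr => e e0.
have zd : cball x d (x + t *: u) by rewrite /cball /closed_ball_ /= distrC nzx ge_min lexx.
have [_ [y0 Py0 [q + <-]] [_ [b /= + <-] <-]] := Phi_sub _ zd y Py.
rewrite addrAC subrr add0r Hhom// /cball /closed_ball_ /= sub0r normrN normrZ u1 mulr1 gtr0_norm//.
move=> [h Hh <-] b1.
have hC b' : `|b'| <= 1 -> C (h + r *: b').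
  move=> b'1; apply: (rBC (r *: b')); last by exists h => //; rewrite addrC.
  by exists b' => //; rewrite /cball /closed_ball_ /= sub0r normrN.
have [|c Cc y0c] := @dist_lt R Y y0 C (fine m + e).
  by rewrite (le_lt_trans (dist_le_exc _ Py0))// -/m mE lte_fin ltrDl.
rewrite (_ : y0 + t *: h + ((r - a) * t) *: b =
  c + ((y0 - c) + ((r - a) * t) *: b) + t *: h); last first.
  by rewrite !addrA (addrC c) addrK addrAC.
apply: le_trans (cone_dist_shift _ cvx con Cc t0 r0 hC) _.
rewrite -EFinD lee_fin ge_max; apply/andP; split; first lra.
have : `|(y0 - c) + ((r - a) * t) *: b| <= `|y0 - c| + (r - a) * t.
  apply: le_trans (ler_normD _ _) _; rewrite lerD2l normrZ.
  by rewrite ger0_norm ?ler_piMr// mulr_ge0// ?subr_ge0 ltW.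
lra.
Qed.

(** * Error bounds *)

(** The point given by Ekeland's principle lies in the ball of radius rho since
    the initial value is below a * rho; were it not a solution, [exc_descent]
    would improve on it. *)
Lemma local_error_bound (R : realType) (X : completeNormedModType R)
  (Y : normedModType R) (C : set Y) (Phi : X -> set Y) (H : X -> X -> set Y)
  (x0 : X) (a rho : R) :
  closed C -> convex_set C -> cone C -> C !=set0 -> 0 < a ->
  (forall x, lsc_at Phi x) -> (forall x, Phi x !=set0) ->
  (forall x, `|x - x0| < rho -> ~ Phi x `<=` C ->
     outer_prederivative Phi x (H x) /\ (a%:E < sigma_prederiv C (H x))%E) ->
  (exc (Phi x0) C < (a * rho)%:E)%E ->
  (dist x0 [set x | Phi x `<=` C] <= exc (Phi x0) C * (a^-1)%:E)%E.
Proof.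
move=> Ccl cvx con C0 a0 lsc ne pre small.
pose f x := exc (Phi x) C.
have f0 x : (0 <= f x)%E by apply: exc_ge0.
have fx0 : (f x0 < +oo)%E by rewrite (lt_trans small)// ltry.
have [z x0z zmin] := ekeland a0 (exc_lower_semicontinuous C0 lsc) f0 fx0.
have [fz le] := ekeland_le_fin f0 fx0 (ltW a0) x0z.
have fE : f x0 = (fine (f x0))%:E by rewrite fineK// ge0_fin_numE.
have fz0 : 0 <= fine (f z) by apply: fine_ge0.
have zS : Phi z `<=` C.
  apply: contrapT => nzS.
  have zx0 : `|z - x0| < rho.
    rewrite -(ltr_pM2l a0); apply: le_lt_trans (_ : fine (f x0) < _); first lra.
    by rewrite -lte_fin -fE.
  have [preH sigH] := pre z zx0 nzS.
  have fz_gt0 : (0 < f z)%E by rewrite ltNge; apply/negP => /(exc_le0 Ccl).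
  have [w wz zw] := exc_descent cvx con a0 sigH preH fz_gt0 fz.
  by move/eqP: wz; apply; exact: zmin.
apply: le_trans (dist_le _ zS) _; rewrite lee_pdivlMr// -/(f x0) fE lee_fin.
by rewrite distrC; lra.
Qed.

(** Bounds by m / a for all real a < s pass to the limit a -> s. With q the
    quotient m / s (which is 0 for infinite s), m / (q + e) is a real below s,
    and taking a above it makes m / a at most q + e. *)
Lemma le_equot (R : realType) (d m s : \bar R) (a0 : R) :
  0 < a0 -> (a0%:E < s)%E -> (0 <= m)%E ->
  (forall a, a0 <= a -> (a%:E < s)%E -> (d <= m * (a^-1)%:E)%E) ->
  (d <= equot m s)%E.
Proof.
rewrite /equot => a00 a0s; case: m => [m| |] m0 le_d //; last by rewrite leey.
rewrite lee_fin in m0; rewrite /=.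
suff [q [q0 -> qlt]] : exists q, [/\ 0 <= q, (m%:E / s)%E = q%:E &
    forall e, 0 < e -> ((m / (q + e))%:E < s)%E].
  apply/lee_addgt0Pr => e e0; have qe0 : 0 < q + e by rewrite ltr_wpDl.
  have b0 : 0 < Num.max a0 (m / (q + e)) by rewrite lt_max a00.
  apply: le_trans (le_d (Num.max a0 (m / (q + e))) _ _) _.
  - by rewrite le_max lexx.
  - by rewrite /Order.max; case: ifP => _; [exact: qlt|exact: a0s].
  rewrite -EFinM -EFinD lee_fin ler_pdivrMr// mulrC -ler_pdivrMr//.
  by rewrite le_max lexx orbT.
move: a0s; case: s le_d => [s| |]// _ a0s; last first.
  by exists 0; split => // [|e _]; rewrite ?invey ?mule0// ltry.
have s0 : 0 < s by rewrite (lt_trans a00)// -lte_fin.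
exists (m / s); split; first by rewrite divr_ge0// ltW.
  by rewrite inver gt_eqF.
move=> e e0; have ms0 : 0 <= m / s by rewrite divr_ge0// ltW.
rewrite lte_fin ltr_pdivrMr ?ltr_wpDl// mulrDr mulrCA divff ?gt_eqF// mulr1.
by rewrite ltrDl mulr_gt0.
Qed.

(** The radii do not depend on the slope a. With eta = delta2 / 4, a merit at
    (p, x) below a * delta2 / 2 allows [local_error_bound] with radius
    delta2 / 2, inside the ball around xbar. A larger merit only requires a
    solution at distance delta2 / 2 from x, and there is one at distance
    delta2 / 4 from xbar, since the merit at (p, xbar) is at most
    a0 * delta2 / 4 for p close to pbar. *)
Lemma uniform_error_bound (R : realType)
  (P Y : normedModType R) (X : completeNormedModType R)
  (C : set Y) (F : P * X -> set Y) (H : P -> X -> X -> set Y)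
  (pbar : P) (xbar : X) (delta1 delta2 a0 : R) :
  closed C -> convex_set C -> cone C -> C !=set0 ->
  (forall z, F z !=set0) -> sol F C pbar xbar ->
  hausdorff_usc_at C (fun p => F (p, xbar)) pbar ->
  0 < delta1 ->
  (forall p, cball pbar delta1 p -> forall x, lsc_at (fun x => F (p, x)) x) ->
  0 < delta2 ->
  (forall p, cball pbar delta2 p -> forall x, cball xbar delta2 x ->
     outer_prederivative (fun x => F (p, x)) x (H p x)) ->
  0 < a0 ->
  exists eta zeta : R, [/\ 0 < eta, 0 < zeta &
    forall p x a, cball pbar zeta p -> cball xbar eta x -> a0 <= a ->
      (a%:E < sigma_inf F C H pbar xbar delta2)%E ->
      (dist x (sol F C p) <= merit F C p x * (a^-1)%:E)%E].
Proof.
move=> Ccl cvx con C0 ne xS usc delta1_0 lsc delta2_0 pre a00.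
have [|d d0 near_xbar] := usc (a0 * delta2 / 4).
  by rewrite divr_gt0// mulr_gt0.
exists (delta2 / 4), (Num.min d (Num.min delta1 delta2)).
split; [by rewrite divr_gt0 | by rewrite !lt_min d0 delta1_0 delta2_0 |].
move=> p x a; rewrite /cball /closed_ball_ /= !le_min => /and3P[pd pd1 pd2] xeta a0a asig.
have a_gt0 : 0 < a by apply: lt_le_trans a0a.
have bound x' : `|xbar - x'| <= delta2 / 4 ->
    (merit F C p x' < (a * (delta2 / 2))%:E)%E ->
    (dist x' (sol F C p) <= merit F C p x' * (a^-1)%:E)%E.
  move=> xx' small.
  apply: (local_error_bound (Phi := fun x => F (p, x)) (H := H p)
    (rho := delta2 / 2)) => // [y|y yx' nyS]; first exact: lsc.
  have yd2 : cball xbar delta2 y.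
    rewrite /cball /closed_ball_ /=; have : `|xbar - y| <= `|xbar - x'| + `|y - x'|.
      by rewrite (distrC y) (le_trans _ (ler_normD _ _))// addrA subrK.
    by move: yx' xx'; lra.
  split; first exact: pre.
  apply: lt_le_trans asig _; apply: ereal_inf_lbound.
  by exists (p, y) => //; split.
have [small|large] := ltP (merit F C p x) (a * (delta2 / 2))%:E.
  exact: bound.
have merit_xbar : (merit F C p xbar <= (a0 * delta2 / 4)%:E)%E.
  apply/exc_leP => y /(near_xbar p pd); rewrite /enlargement /=.
  apply: le_trans; apply: le_ereal_inf_tmp => _ [_ [c Fc [b Cb <-]] <-].
  by apply: dist_le; apply: convex_cone_add => //; exact: xS Fc.
apply: le_trans (dist_triangle x xbar _) _.
have d_xbar : (dist xbar (sol F C p) <= (delta2 / 4)%:E)%E.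
  apply: le_trans (bound xbar _ _) _.
  - by rewrite subrr normr0 divr_ge0// ltW.
  - rewrite (le_lt_trans merit_xbar)// lte_fin.
    have : a0 * delta2 <= a * delta2 by rewrite ler_wpM2r// ltW.
    have : 0 < a * delta2 by rewrite mulr_gt0.
    lra.
  rewrite lee_pdivrMr// (le_trans merit_xbar)// lee_fin.
  have : a0 * delta2 <= a * delta2 by rewrite ler_wpM2r// ltW.
  lra.
apply: le_trans (leeD2l _ d_xbar) _; rewrite -EFinD lee_pdivlMr//.
apply: le_trans large; rewrite lee_fin [leLHS]mulrC (ler_wpM2l (ltW a_gt0))// distrC.
by move: xeta; lra.
Qed.

(** * Stability of the solution mapping *)

Theorem proposition4p1 (R : realType)
  (P Y : normedModType R) (X : completeNormedModType R)
  (C : set Y) (F : P * X -> set Y) (H : P -> X -> X -> set Y)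
  (pbar : P) (xbar : X) (delta2 : R)
  (C_closed : closed C) (C_convex : convex_set C) (C_cone : cone C)
  (C_int : C° !=set0)
  (F_nonempty : forall z, F z !=set0)
  (h_i : sol F C pbar xbar)
  (h_ii : hausdorff_usc_at C (fun p => F (p, xbar)) pbar)
  (h_iii : exists2 delta1 : R, 0 < delta1 &
     forall p, cball pbar delta1 p -> forall x, lsc_at (fun x => F (p, x)) x)
  (delta2_gt0 : 0 < delta2)
  (h_iv : forall p, cball pbar delta2 p -> forall x, cball xbar delta2 x ->
     outer_prederivative (fun x => F (p, x)) x (H p x))
  (h_v : (0 < sigma_inf F C H pbar xbar delta2)%E) :
  (exists eta zeta : R, [/\ 0 < eta, 0 < zeta &
     forall p x, cball pbar zeta p -> cball xbar eta x ->
       (dist x (sol F C p)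
          <= equot (merit F C p x) (sigma_inf F C H pbar xbar delta2))%E])
  /\
  (forall l : R, 0 < l ->
     (exists tau s : R, [/\ 0 < tau, 0 < s &
        forall x, cball xbar s x ->
          lipschitz_rate_in (fun p => F (p, x)) l (cball pbar tau)]) ->
     aubin_continuous (sol F C) pbar xbar /\
     (lip (sol F C) pbar xbar
        <= equot l%:E (sigma_inf F C H pbar xbar delta2))%E).
Proof.
have [delta1 delta1_gt0 lsc] := h_iii.
have C0 : C !=set0 by case: C_int => c /interior_subset; exists c.
have [a0 a0_gt0 a0_lt] : exists2 a0 : R, 0 < a0 &
    (a0%:E < sigma_inf F C H pbar xbar delta2)%E.
  move: h_v; case: (sigma_inf _ _ _ _ _ _) => [s| |]//.
  - by rewrite lte_fin => s0; exists (s / 2); rewrite ?lte_fin; lra.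
  - by exists 1; rewrite ?ltry.
have [eta [zeta [eta0 zeta0 bound]]] := uniform_error_bound C_closed C_convex
  C_cone C0 F_nonempty h_i h_ii delta1_gt0 lsc delta2_gt0 h_iv a0_gt0.
split.
  exists eta, zeta; split=> // p x pz xe.
  apply: (le_equot a0_gt0 a0_lt) => [|a a0a alt]; first exact: exc_ge0.
  exact: bound.
(* For a solution x of the parameter p2, exc (F (p1, x)) C is at most
   exc (F (p1, x)) (F (p2, x)), which the Lipschitz property bounds. *)
move=> l l0 [tau [s [tau0 s0 Flip]]].
have rate a : a0 <= a -> (a%:E < sigma_inf F C H pbar xbar delta2)%E ->
    aubin_rate (sol F C) pbar xbar (l / a).
  move=> a0a alt; have a_gt0 : 0 < a by apply: lt_le_trans a0a.
  split; [exact: h_i | by rewrite divr_gt0 |].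
  exists (Num.min zeta tau), (Num.min eta s).
  split; [by rewrite lt_min zeta0 | by rewrite lt_min eta0 |].
  rewrite /cball /closed_ball_ /= => p1 p2 x; rewrite !le_min => /andP[p1z p1t] /andP[p2z p2t].
  move=> p2x /andP[xe xs]; apply: le_trans (bound p1 x a p1z xe a0a alt) _.
  rewrite lee_pdivrMr// -EFinM mulrAC divfK ?gt_eqF//.
  apply: le_trans (Flip x xs p1 p2 p1t p2t); rewrite /haus le_max.
  by apply/orP; left; exact: exc_subset_r.
split; first by exists (l / a0); exact: rate.
apply: (le_equot a0_gt0 a0_lt) => [|a a0a alt]; first by rewrite lee_fin ltW.
by apply: ereal_inf_lbound; exists (l / a) => //; exact: rate.
Qed.
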